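(* Let $f:\mathbb{R}^n\to\mathbb{R}$ be twice continuously differentiable and let $x^0\in\mathbb{R}^n$ be such that $\mathscr{L}_f(x^0)$ is compact. Let $U_g,U_H,r_d$ be as in the context, and suppose that for some $\nu\in(0,1]$ and $H_f\ge 1$ one has $\|\nabla^2 f(y)-\nabla^2 f(x)\|\le H_f\|y-x\|^\nu$ for all $x,y\in\mathscr{L}_f(x^0;r_d)$. Let $x^*$ be an arbitrary nondegenerate local minimizer of $f$, with $\nabla^2 f(x^* )\succeq\mu I$ for some $\mu>0$. Then there exist $\delta>0$ and $c>0$ such that, with $S=B_\delta(x^* )\cap\{x: f(x)\le f(x^* )+c\}$, the following holds for the sequence $\{x^k\}_{k\ge0}$ generated by Algorithm 2 (described in the context) from $x^0$: if $x^{k_0}\in S$ for some $k_0\ge0$, then $\{x^k\}_{k\ge k_0}\subseteq S$ and $\{x^k\}_{k\ge k_0}$ converges to $x^*$ superlinearly in the sense that $$\|x^{k+1}-x^*\|\le \mathcal{O}\Big(\|x^k-x^*\|^{\min\{1+\nu,\frac32\}}\Big),\qquad k\ge k_0,$$ i.e. there is a constant $C$ independent of $k$ with $\|x^{k+1}-x^*\|\le C\|x^k-x^*\|^{\min\{1+\nu,3/2\}}$ for all $k\ge k_0$ (if the algorithm terminates, the assertions concern the iterates that are generated).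
   Context: Notation. $\|\cdot\|$ is the Euclidean norm of vectors and the spectral norm of matrices; $B_\delta(x^* )=\{x:\|x-x^*\|\le\delta\}$; $\mathrm{sgn}(z)=1$ if $z\ge 0$ and $-1$ if $z<0$. $\mathscr{L}_f(u)=\{x: f(x)\le f(u)\}$ and, for $r\ge 0$, $\mathscr{L}_f(u;r)=\{x:\|x-x'\|\le r \text{ for some } x'\in\mathscr{L}_f(u)\}$. Since $\mathscr{L}_f(x^0)$ is compact, fix $U_g>0$, $U_H>0$ with $\|\nabla f(x)\|\le U_g$, $\|\nabla^2 f(x)\|\le U_H$ for all $x\in\mathscr{L}_f(x^0)$, and set $r_d=\max\{1.1,1.1U_g,U_H\}$. Subroutine CappedCG$(H,g,\zeta,\sigma)$ (Royer, O'Neill, Wright). Input: symmetric $H\in\mathbb{R}^{n\times n}$, $g\neq 0$, relative accuracy $\zeta\in(0,1)$, damping $\sigma>0$. Put $\bar H=H+2\sigma I$, $U=0$, and, always as functions of the current $U$, $\kappa=(U+2\sigma)/\sigma$, $\hat\zeta=\zeta/(3\kappa)$, $\tau=\sqrt\kappa/(\sqrt\kappa+1)$, $T=4\kappa^4/(1-\sqrt\tau)^2$. Start with $y^0=0$, $r^0=g$, $p^0=-g$, $j=0$. If $(p^0)^T\bar Hp^0<\sigma\|p^0\|^2$ return $(p^0,\mathrm{NC})$. Otherwise loop: $a_j=\|r^j\|^2/(p^j)^T\bar Hp^j$, $y^{j+1}=y^j+a_jp^j$, $r^{j+1}=r^j+a_j\bar Hp^j$, $b_{j+1}=\|r^{j+1}\|^2/\|r^j\|^2$,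 $p^{j+1}=-r^{j+1}+b_{j+1}p^j$; $j\leftarrow j+1$; replace $U$ by the maximum of $U$ and the ratios $\|Hv\|/\|v\|$ for $v\in\{p^0,p^j,y^j,r^j\}$, $v\neq0$; then: if $(y^j)^T\bar Hy^j<\sigma\|y^j\|^2$ return $(y^j,\mathrm{NC})$; else if $\|r^j\|\le\hat\zeta\|r^0\|$ return $(y^j,\mathrm{SOL})$; else if $(p^j)^T\bar Hp^j<\sigma\|p^j\|^2$ return $(p^j,\mathrm{NC})$; else if $\|r^j\|>\sqrt T\tau^{j/2}\|r^0\|$, compute $a_j=\|r^j\|^2/(p^j)^T\bar Hp^j$ and $y^{j+1}=y^j+a_jp^j$, find $i\in\{0,\dots,j-1\}$ with $(y^{j+1}-y^i)^T\bar H(y^{j+1}-y^i)<\sigma\|y^{j+1}-y^i\|^2$ and return $(y^{j+1}-y^i,\mathrm{NC})$. Known fact (Royer et al.): it returns an output $(d,\text{d\_type})$ such that, if d\_type $=$ SOL, $\sigma\|d\|^2\le d^T(H+2\sigma I)d$, $\|d\|\le1.1\sigma^{-1}\|g\|$, $d^Tg=-d^T(H+2\sigma I)d$, $\|(H+2\sigma I)d+g\|\le\zeta\sigma\|d\|/2$; and if d\_type $=$ NC, $d^Tg\le0$ and $d^THd/\|d\|^2<-\sigma$. Algorithm 2. Input: $x^0$, $\gamma_0\ge1$, $\eta\in(0,1/2]$, $\theta\in(0,1)$. Put $c_{\rm sol}=\eta(1-\eta)\theta/400$. For $k=0,1,\dots$ while $\nabla f(x^k)\ne0$: set $H_k=\nabla^2f(x^k)$,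 $g_k=\nabla f(x^k)$, $\varepsilon_k=(\gamma_k\|g_k\|)^{1/2}$, $\zeta_k=\min\{1/2,\|g_k\|^{1/2}\}$, and call CappedCG with matrix $H_k$, vector $g_k$, damping $\sigma=\varepsilon_k$ and accuracy $\zeta=\zeta_k$ to get $(d,\text{d\_type})$. If d\_type $=$ NC: $d^k=-\mathrm{sgn}(d^Tg_k)\frac{|d^TH_kd|}{\|d\|^3}d$; $\alpha_k=\theta^{j_k}$ with $j_k$ the smallest integer $j\ge0$ with $f(x^k+\theta^jd^k)<f(x^k)-\frac{\eta}{2}\theta^{2j}\|d^k\|^3$; if $\|\nabla f(x^k+\alpha_kd^k)\|>\|g_k\|/2$ and $\alpha_k<\theta/\gamma_k$, set $\gamma_{k+1}=2\gamma_k$, otherwise $\gamma_{k+1}=\gamma_k$. If d\_type $=$ SOL: $d^k=d$; if $f(x^k+d^k)\le f(x^k)$ and $\|\nabla f(x^k+d^k)\|\le\|g_k\|/2$ set $\alpha_k=1$; otherwise $\alpha_k=\theta^{j_k}$ with $j_k$ the smallest integer $j\ge0$ with $f(x^k+\theta^jd^k)<f(x^k)-\eta\varepsilon_k\theta^j\|d^k\|^2$. If $\|\nabla f(x^k+\alpha_kd^k)\|>\|g_k\|/2$ and $f(x^k)-f(x^k+\alpha_kd^k)<c_{\rm sol}\gamma_k^{-1/2}\|g_k\|^{3/2}$, set $\gamma_{k+1}=2\gamma_k$, otherwise $\gamma_{k+1}=\gamma_k$. Then $x^{k+1}=x^k+\alpha_kd^k$. *)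

(* Defs.v *)
(* Points of R^n are column vectors 'cV[R]_n.
   The library norm of a matrix or a vector is the sup norm of its entries.
   It provides the topology (compactness, differentiability, limits), which
   in finite dimension is the Euclidean one; every quantitative bound below
   uses [enorm] and [specnorm] instead. *)

From mathcomp Require Export all_boot all_order all_algebra.
From mathcomp Require Export all_classical all_reals all_analysis.

Set Implicit Arguments.
Unset Strict Implicit.
Unset Printing Implicit Defensive.

Export Order.TTheory GRing.Theory Num.Theory numFieldNormedType.Exports.

Local Open Scope classical_set_scope.
Local Open Scope ring_scope.

Definition dotv (R : realType) (n : nat) (u v : 'cV[R]_n) : R :=
  (u^T *m v) 0 0.

Definition enorm (R : realType) (n : nat) (v : 'cV[R]_n) : R :=
  Num.sqrt (dotv v v).

Definition qform (R : realType) (n : nat) (A : 'M[R]_n) (v : 'cV[R]_n) : R :=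
  dotv v (A *m v).

Definition specnorm (R : realType) (n : nat) (A : 'M[R]_n) : R :=
  sup [set enorm (A *m v) | v in [set v : 'cV[R]_n | enorm v <= 1]].

Definition posdef (R : realType) (n : nat) (A : 'M[R]_n) : Prop :=
  forall v : 'cV[R]_n, v != 0 -> 0 < qform A v.

(* Only used between symmetric matrices. *)
Definition loewner_ge (R : realType) (n : nat) (A B : 'M[R]_n) : Prop :=
  forall v : 'cV[R]_n, qform B v <= qform A v.

Definition cball (R : realType) (n : nat) (a : 'cV[R]_n) (r : R)
  : set 'cV[R]_n := [set x | enorm (x - a) <= r].

Definition sgn1 (R : realType) (z : R) : R := if 0 <= z then 1 else -1.

Definition gradient (R : realType) (n : nat) (f : 'cV[R]_n -> R)
    (x : 'cV[R]_n) : 'cV[R]_n :=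
  \col_i 'D_(delta_mx i 0) f x.

Definition hessian (R : realType) (n : nat) (f : 'cV[R]_n -> R)
    (x : 'cV[R]_n) : 'M[R]_n :=
  \matrix_(i, j) 'D_(delta_mx j 0) (fun y => gradient f y i 0) x.

Definition twice_continuously_differentiable (R : realType) (n : nat)
    (f : 'cV[R]_n -> R) : Prop :=
  [/\ forall x, differentiable f x,
      forall x, differentiable (gradient f) x
    & continuous (hessian f)].

Definition nondegenerate_local_minimizer (R : realType) (n : nat)
    (f : 'cV[R]_n -> R) (xs : 'cV[R]_n) : Prop :=
  (\forall y \near xs, f xs <= f y) /\ posdef (hessian f xs).

Definition sublevel (R : realType) (n : nat) (f : 'cV[R]_n -> R)
    (u : 'cV[R]_n) : set 'cV[R]_n := [set x | f x <= f u].

Definition sublevel_nbhd (R : realType) (n : nat) (f : 'cV[R]_n -> R)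
    (u : 'cV[R]_n) (r : R) : set 'cV[R]_n :=
  [set x | exists2 x', sublevel f u x' & enorm (x - x') <= r].

Definition radius_d (R : realType) (Ug UH : R) : R :=
  Num.max (11 / 10) (Num.max (11 / 10 * Ug) UH).

Variant dtype := SOL | NC.

Record cg_state (R : realType) (n : nat) := CGState {
  cg_y : 'cV[R]_n;
  cg_r : 'cV[R]_n;
  cg_p : 'cV[R]_n;
  cg_U : R }.

Definition damped (R : realType) (n : nat) (H : 'M[R]_n) (sigma : R)
  : 'M[R]_n := H + (2 * sigma)%:M.

Definition low_curvature (R : realType) (n : nat) (H : 'M[R]_n) (sigma : R)
    (v : 'cV[R]_n) : bool :=
  qform (damped H sigma) v < sigma * enorm v ^+ 2.

Definition cg_kappa (R : realType) (sigma U : R) : R :=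
  (U + 2 * sigma) / sigma.

Definition cg_zeta (R : realType) (zeta sigma U : R) : R :=
  zeta / (3 * cg_kappa sigma U).

Definition cg_tau (R : realType) (sigma U : R) : R :=
  Num.sqrt (cg_kappa sigma U) / (Num.sqrt (cg_kappa sigma U) + 1).

Definition cg_T (R : realType) (sigma U : R) : R :=
  4 * cg_kappa sigma U ^+ 4 / (1 - Num.sqrt (cg_tau sigma U)) ^+ 2.

Definition cg_init (R : realType) (n : nat) (g : 'cV[R]_n) : cg_state R n :=
  CGState 0 g (- g) 0.

Definition cg_stepsize (R : realType) (n : nat) (H : 'M[R]_n) (sigma : R)
    (s : cg_state R n) : R :=
  enorm (cg_r s) ^+ 2 / qform (damped H sigma) (cg_p s).

Definition cg_next_y (R : realType) (n : nat) (H : 'M[R]_n) (sigma : R)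
    (s : cg_state R n) : 'cV[R]_n :=
  cg_y s + cg_stepsize H sigma s *: cg_p s.

Definition cg_next (R : realType) (n : nat) (H : 'M[R]_n) (g : 'cV[R]_n)
    (sigma : R) (s : cg_state R n) : cg_state R n :=
  let y := cg_next_y H sigma s in
  let r := cg_r s + cg_stepsize H sigma s *: (damped H sigma *m cg_p s) in
  let b := enorm r ^+ 2 / enorm (cg_r s) ^+ 2 in
  let p := - r + b *: cg_p s in
  let U := \big[Num.max/cg_U s]_(v <- [:: - g; p; y; r] | v != 0)
             (enorm (H *m v) / enorm v) in
  CGState y r p U.

(* The state with index j, right after U has been updated. *)
Definition cg_iter (R : realType) (n : nat) (H : 'M[R]_n) (g : 'cV[R]_n)
    (sigma : R) (j : nat) : cg_state R n :=
  iter j (cg_next H g sigma) (cg_init g).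

Definition cg_small_residual (R : realType) (n : nat) (g : 'cV[R]_n)
    (zeta sigma : R) (s : cg_state R n) : bool :=
  enorm (cg_r s) <= cg_zeta zeta sigma (cg_U s) * enorm g.

Definition cg_slow_decay (R : realType) (n : nat) (g : 'cV[R]_n)
    (sigma : R) (j : nat) (s : cg_state R n) : bool :=
  Num.sqrt (cg_T sigma (cg_U s)) * cg_tau sigma (cg_U s) `^ (j%:R / 2)
    * enorm g < enorm (cg_r s).

(* The tests of iteration j return (d, t).  The last one may return any
   difference of the required kind, so this is a relation. *)
Definition cg_returns (R : realType) (n : nat) (H : 'M[R]_n) (g : 'cV[R]_n)
    (zeta sigma : R) (j : nat) (d : 'cV[R]_n) (t : dtype) : Prop :=
  let s := cg_iter H g sigma j in
  if low_curvature H sigma (cg_y s) then d = cg_y s /\ t = NC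
  else if cg_small_residual g zeta sigma s then d = cg_y s /\ t = SOL
  else if low_curvature H sigma (cg_p s) then d = cg_p s /\ t = NC
  else if cg_slow_decay g sigma j s then
    t = NC /\
    exists2 i : nat, (i < j)%N
      & d = cg_next_y H sigma s - cg_y (cg_iter H g sigma i)
        /\ low_curvature H sigma d
  else False.

Definition cg_continues (R : realType) (n : nat) (H : 'M[R]_n) (g : 'cV[R]_n)
    (zeta sigma : R) (j : nat) : bool :=
  let s := cg_iter H g sigma j in
  [&& ~~ low_curvature H sigma (cg_y s), ~~ cg_small_residual g zeta sigma s,
      ~~ low_curvature H sigma (cg_p s) & ~~ cg_slow_decay g sigma j s].

(* CappedCG(H, g, zeta, sigma) may return (d, t). *)
Definition capped_cg (R : realType) (n : nat) (H : 'M[R]_n) (g : 'cV[R]_n)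
    (zeta sigma : R) (d : 'cV[R]_n) (t : dtype) : Prop :=
  if low_curvature H sigma (- g) then d = - g /\ t = NC
  else exists j : nat,
    [/\ (0 < j)%N,
        forall i : nat, (0 < i < j)%N -> cg_continues H g zeta sigma i
      & cg_returns H g zeta sigma j d t].

Definition least_index (P : pred nat) (j : nat) : Prop :=
  P j /\ forall i : nat, (i < j)%N -> ~~ P i.

Definition c_sol (R : realType) (eta theta : R) : R :=
  eta * (1 - eta) * theta / 400.

(* In the following three relations, gamma is gamma_k, and x', gamma' are
   x^{k+1}, gamma_{k+1}. *)
Definition nc_step (R : realType) (n : nat) (f : 'cV[R]_n -> R)
    (eta theta : R) (x : 'cV[R]_n) (gamma : R) (d : 'cV[R]_n)
    (x' : 'cV[R]_n) (gamma' : R) : Prop :=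
  let g := gradient f x in
  let dk := - (sgn1 (dotv d g) * (`|qform (hessian f x) d| / enorm d ^+ 3))
            *: d in
  exists alpha : R,
  [/\ exists2 j : nat,
        least_index (fun i => f (x + theta ^+ i *: dk)
                     < f x - eta / 2 * theta ^+ (2 * i) * enorm dk ^+ 3) j
        & alpha = theta ^+ j,
      x' = x + alpha *: dk
    & gamma' = if (enorm g / 2 < enorm (gradient f x'))
                  && (alpha < theta / gamma)
               then 2 * gamma else gamma].

Definition sol_step (R : realType) (n : nat) (f : 'cV[R]_n -> R)
    (eta theta : R) (x : 'cV[R]_n) (gamma : R) (d : 'cV[R]_n)
    (x' : 'cV[R]_n) (gamma' : R) : Prop :=
  let g := gradient f x in
  let eps := Num.sqrt (gamma * enorm g) in
  exists alpha : R,
  [/\ if (f (x + d) <= f x) && (enorm (gradient f (x + d)) <= enorm g / 2)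
      then alpha = 1
      else exists2 j : nat,
        least_index (fun i => f (x + theta ^+ i *: d)
                     < f x - eta * eps * theta ^+ i * enorm d ^+ 2) j
        & alpha = theta ^+ j,
      x' = x + alpha *: d
    & gamma' = if (enorm g / 2 < enorm (gradient f x'))
                  && (f x - f x' < c_sol eta theta * gamma `^ (- (1 / 2))
                                   * enorm g `^ (3 / 2))
               then 2 * gamma else gamma].

Definition algorithm_step (R : realType) (n : nat) (f : 'cV[R]_n -> R)
    (eta theta : R) (x : 'cV[R]_n) (gamma : R)
    (x' : 'cV[R]_n) (gamma' : R) : Prop :=
  let g := gradient f x in
  let eps := Num.sqrt (gamma * enorm g) in
  let zeta := Num.min (1 / 2) (Num.sqrt (enorm g)) in
  exists (d : 'cV[R]_n) (t : dtype),
    capped_cg (hessian f x) g zeta eps d t /\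
    match t with
    | NC => nc_step f eta theta x gamma d x' gamma'
    | SOL => sol_step f eta theta x gamma d x' gamma'
    end.

(* The entries x 0, ..., x k and gam 0, ..., gam k are iterates generated by
   the algorithm; entries after termination are unconstrained. *)
Definition generated (R : realType) (n : nat) (f : 'cV[R]_n -> R)
    (x0 : 'cV[R]_n) (gamma0 eta theta : R)
    (x : nat -> 'cV[R]_n) (gam : nat -> R) (k : nat) : Prop :=
  [/\ x 0%N = x0, gam 0%N = gamma0
    & forall i : nat, (i < k)%N ->
        gradient f (x i) != 0 /\
        algorithm_step f eta theta (x i) (gam i) (x i.+1) (gam i.+1)].

(* Main.v *)
Require Import Defs.
From mathcomp Require Import ring lra.

Set Implicit Arguments.
Unset Strict Implicit.
Unset Printing Implicit Defensive.

Local Open Scope classical_set_scope.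
Local Open Scope ring_scope.

(** Fix a ball around xs on which the Hessian H varies by at most mu / 8, hence
    stays above mu / 2.  Inside it the algorithm is a damped inexact Newton
    method.  An output of negative curvature type has curvature below -sigma,
    which a positive semidefinite Hessian excludes
    ([capped_cg_NC_curvature], [low_curvature_psd]), so every call returns a
    SOL direction d.  With r = (H + 2 sigma) d + g, the stopping test of the
    subroutine alone gives |r| <= zeta |g| / 6 and |r| <= sigma |d| / 4
    ([capped_cg_SOL_residual]).

    From there three estimates hold with constants independent of gamma.
    - The identity (H + 2 sigma)(x + d - xs) =
      2 sigma (x - xs) + (H (x - xs) - g) + r bounds the new error
      ([damped_step_error]).  As the last two terms are small compared with
      (mu / 2) |x - xs|, the error does not increase, however large sigma is.
    - The decrease f x - f (x + d) is at least (7 / 4) sigma |d|^2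
      ([damped_step_decrease]), so the unit step passes the line search.
    - If the unit step fails to halve the gradient, then sigma |d| is at least
      a fixed fraction of |g| ([damped_step_gradient]), and the decrease
      exceeds the threshold under which gamma is doubled
      ([decrease_above_threshold]).

    Hence once an iterate lies in the ball, all later ones do, and gamma keeps
    its current value forever ([algorithm_step_near_minimizer],
    [iterates_stay]).  This is what allows the radius to be chosen before the
    sequence, although gamma may be arbitrarily large on arrival; only the
    contraction ratio and the constant C depend on it.  With gamma frozen,
    sigma is bounded and the error contracts geometrically ([iterates_cvg]).
    In the identity above, sigma |x - xs| and |r| are of order
    |x - xs|^(3/2), while H (x - xs) - g is of order |x - xs|^(1 + nu) by
    Hoelder continuity; this is the superlinear rate ([iterates_rate]).

    The sublevel condition in S is preserved for any c, here c = 1, because the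
    algorithm never increases f. *)

(** * Euclidean and spectral norms *)

Section EuclideanGeometry.
Variables (R : realType) (n : nat).
Implicit Types (u v w : 'cV[R]_n) (A B : 'M[R]_n) (a k : R).

Lemma dotvE u v : dotv u v = \sum_i u i 0 * v i 0.
Proof. by rewrite /dotv mxE; apply: eq_bigr => i _; rewrite mxE. Qed.

Lemma dotvC u v : dotv u v = dotv v u.
Proof. by rewrite !dotvE; apply: eq_bigr => i _; rewrite mulrC. Qed.

Lemma dotvDr u v w : dotv u (v + w) = dotv u v + dotv u w.
Proof. by rewrite /dotv mulmxDr mxE. Qed.

Lemma dotvDl u v w : dotv (v + w) u = dotv v u + dotv w u.
Proof. by rewrite dotvC dotvDr !(dotvC u). Qed.

Lemma dotvZr a u v : dotv u (a *: v) = a * dotv u v.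
Proof. by rewrite /dotv -scalemxAr mxE. Qed.

Lemma dotvZl a u v : dotv (a *: u) v = a * dotv u v.
Proof. by rewrite dotvC dotvZr dotvC. Qed.

Lemma dotvNr u v : dotv u (- v) = - dotv u v.
Proof. by rewrite -scaleN1r dotvZr mulN1r. Qed.

Lemma dotvNl u v : dotv (- u) v = - dotv u v.
Proof. by rewrite dotvC dotvNr dotvC. Qed.

Lemma dotvBr u v w : dotv u (v - w) = dotv u v - dotv u w.
Proof. by rewrite dotvDr dotvNr. Qed.

Lemma dotv_ge0 v : 0 <= dotv v v.
Proof. by rewrite dotvE sumr_ge0// => i _; rewrite -expr2 sqr_ge0. Qed.

Lemma dotv_eq0 v : (dotv v v == 0) = (v == 0).
Proof.
apply/idP/eqP => [|->]; last by rewrite dotvE big1// => i _; rewrite mxE mul0r.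
rewrite dotvE psumr_eq0 => [/allP v0|i _]; last by rewrite -expr2 sqr_ge0.
apply/matrixP => i j; rewrite ord1 mxE; apply/eqP.
by have := v0 i; rewrite mem_index_enum -expr2 sqrf_eq0 /= => ->.
Qed.

Lemma enorm_ge0 v : 0 <= enorm v.
Proof. exact: sqrtr_ge0. Qed.

Lemma enorm_sqr v : enorm v ^+ 2 = dotv v v.
Proof. by rewrite sqr_sqrtr// dotv_ge0. Qed.

Lemma enorm_eq0 v : (enorm v == 0) = (v == 0).
Proof. by rewrite -sqrf_eq0 enorm_sqr dotv_eq0. Qed.

Lemma enorm0 : enorm (0 : 'cV[R]_n) = 0.
Proof. by apply/eqP; rewrite enorm_eq0. Qed.

Lemma enorm_gt0 v : (0 < enorm v) = (v != 0).
Proof. by rewrite lt0r enorm_ge0 enorm_eq0 andbT. Qed.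

Lemma enormZ a v : enorm (a *: v) = `|a| * enorm v.
Proof.
by rewrite /enorm dotvZl dotvZr mulrA -expr2 sqrtrM ?sqr_ge0// sqrtr_sqr.
Qed.

Lemma enormN v : enorm (- v) = enorm v.
Proof. by rewrite -scaleN1r enormZ normrN1 mul1r. Qed.

Lemma enormB u v : enorm (u - v) = enorm (v - u).
Proof. by rewrite -enormN opprB. Qed.

Lemma cauchy_schwarz u v : dotv u v <= enorm u * enorm v.
Proof.
have [->|v0] := eqVneq v 0.
  by rewrite enorm0 mulr0 dotvE big1// => i _; rewrite mxE mulr0.
apply: le_trans (ler_norm _) _.
rewrite -ler_sqr ?nnegrE ?mulr_ge0 ?enorm_ge0// exprMn !enorm_sqr.
rewrite real_normK ?num_real//.
have v_gt0 : 0 < dotv v v by rewrite lt0r dotv_eq0 v0 dotv_ge0.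
have := dotv_ge0 (dotv v v *: u - dotv u v *: v).
rewrite dotvDl dotvNl !dotvBr !dotvZl !dotvZr (dotvC v u) => h.
rewrite -subr_ge0 -(pmulr_rge0 _ v_gt0).
by move: h; apply: etrans; congr (_ <= _); ring.
Qed.

Lemma enormD u v : enorm (u + v) <= enorm u + enorm v.
Proof.
rewrite -ler_sqr ?nnegrE ?addr_ge0 ?enorm_ge0//.
rewrite sqrrD !enorm_sqr dotvDl !dotvDr (dotvC v u).
have := cauchy_schwarz u v; lra.
Qed.

Lemma enorm_sub u v : enorm (u - v) <= enorm u + enorm v.
Proof. by rewrite -[leRHS](congr1 _ (enormN v)); exact: enormD. Qed.

Lemma normc_le_enorm v i : `|v i 0| <= enorm v.
Proof.
rewrite -ler_sqr ?nnegrE ?enorm_ge0// enorm_sqr dotvE (bigD1 i)//= -expr2.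
rewrite real_normK ?num_real// lerDl sumr_ge0// => j _.
by rewrite -expr2 sqr_ge0.
Qed.

Lemma mxnorm_le_enorm v : `|v| <= enorm v.
Proof.
rewrite [`|v|]mx_normrE; apply: bigmax_le => [|[i j] _]; first exact: enorm_ge0.
by rewrite ord1 /= normc_le_enorm.
Qed.

(** A crude entrywise bound: it makes the supremum defining [specnorm] finite,
    and it carries continuity for the sup norm over to [specnorm]. *)
Lemma enorm_mulmx_mxnorm A v : enorm (A *m v) <= n%:R * `|A| * enorm v.
Proof.
have A_ge0 := normr_ge0 A.
have nA : 0 <= n%:R * `|A| by rewrite mulr_ge0.
rewrite -ler_sqr ?nnegrE ?mulr_ge0 ?enorm_ge0// enorm_sqr dotvE.
have row i : ((A *m v) i 0) ^+ 2 <= n%:R * (`|A| ^+ 2 * enorm v ^+ 2).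
  have -> : (A *m v) i 0 = dotv (row i A)^T v.
    by rewrite dotvE mxE; apply: eq_bigr => j _; rewrite !mxE.
  apply: (@le_trans _ _ (enorm (row i A)^T ^+ 2 * enorm v ^+ 2)).
    rewrite -exprMn -[leLHS]real_normK ?num_real//.
    rewrite ler_sqr ?nnegrE ?mulr_ge0 ?enorm_ge0// ler_norml cauchy_schwarz.
    by rewrite lerNl -dotvNr -(enormN v) cauchy_schwarz.
  rewrite mulrA ler_wpM2r ?sqr_ge0// enorm_sqr dotvE.
  rewrite [leRHS]mulr_natl -[X in _ *+ X]card_ord -sumr_const ler_sum// => j _.
  rewrite -expr2 !mxE -[leLHS]real_normK ?num_real// ler_sqr ?nnegrE//.
  rewrite [leRHS]mx_normrE.
  exact: (le_bigmax _ (fun ij : 'I_n * 'I_n => `|A ij.1 ij.2|) (i, j)).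
rewrite [leRHS](_ : _ = \sum_(i < n) n%:R * (`|A| ^+ 2 * enorm v ^+ 2)).
  by apply: ler_sum => i _; rewrite -expr2.
by rewrite sumr_const card_ord -mulr_natl; ring.
Qed.

Lemma enorm_mulmx_unit_le_specnorm A v :
  enorm v <= 1 -> enorm (A *m v) <= specnorm A.
Proof.
move=> v1; apply: ub_le_sup; last by exists v.
exists (n%:R * `|A|) => _ [w /= w1 <-].
by rewrite (le_trans (enorm_mulmx_mxnorm _ _))// ler_piMr// mulr_ge0.
Qed.

Lemma specnorm_ge0 A : 0 <= specnorm A.
Proof.
have := @enorm_mulmx_unit_le_specnorm A 0.
by rewrite mulmx0 enorm0; exact.
Qed.

Lemma enorm_mulmx A v : enorm (A *m v) <= specnorm A * enorm v.
Proof.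
have [->|v0] := eqVneq v 0; first by rewrite mulmx0 !enorm0 mulr0.
have v_gt0 : 0 < enorm v by rewrite enorm_gt0.
have Ev : `|(enorm v)^-1| = (enorm v)^-1.
  by rewrite ger0_norm ?invr_ge0 ?enorm_ge0.
have := @enorm_mulmx_unit_le_specnorm A ((enorm v)^-1 *: v).
rewrite -scalemxAr !enormZ Ev mulVf ?gt_eqF// mulrC ler_pdivrMr//.
exact.
Qed.

Lemma specnorm_le_mxnorm A : specnorm A <= n%:R * `|A|.
Proof.
apply: ge_sup => [|_ [v /= v1 <-]].
  by exists (enorm (A *m 0)), 0 => //=; rewrite enorm0.
apply: le_trans (enorm_mulmx_mxnorm _ _) _.
by rewrite ler_piMr// mulr_ge0.
Qed.

Lemma qformB A B v : qform (A - B) v = qform A v - qform B v.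
Proof. by rewrite /qform mulmxBl dotvBr. Qed.

Lemma qform_scalar a v : qform a%:M v = a * enorm v ^+ 2.
Proof. by rewrite /qform mul_scalar_mx dotvZr enorm_sqr. Qed.

Lemma qform_le_specnorm A v : qform A v <= specnorm A * enorm v ^+ 2.
Proof.
apply: le_trans (cauchy_schwarz _ _) _.
by rewrite mulrC expr2 mulrA ler_wpM2r ?enorm_ge0// enorm_mulmx.
Qed.

Lemma qform_damped A a v :
  qform (damped A a) v = qform A v + 2 * a * enorm v ^+ 2.
Proof.
by rewrite /qform /damped mulmxDl dotvDr mul_scalar_mx dotvZr enorm_sqr.
Qed.

Lemma mul_damped A a v : damped A a *m v = A *m v + (2 * a) *: v.
Proof. by rewrite /damped mulmxDl mul_scalar_mx. Qed.

(** Coercivity turns into a lower bound on the image by Cauchy-Schwarz, which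
    is how every inverse of a Hessian is estimated here. *)
Lemma coercive_enorm_le A k v :
  k * enorm v ^+ 2 <= qform A v -> k * enorm v <= enorm (A *m v).
Proof.
have [->|v0] := eqVneq v 0; first by rewrite mulmx0 enorm0 mulr0.
have v_gt0 : 0 < enorm v by rewrite enorm_gt0.
move=> h; rewrite -(ler_pM2r v_gt0) -mulrA -expr2 (le_trans h)//.
by rewrite mulrC cauchy_schwarz.
Qed.

Lemma coercive_perturbation A B a k v :
  a * enorm v ^+ 2 <= qform A v -> specnorm (A - B) <= k ->
  (a - k) * enorm v ^+ 2 <= qform B v.
Proof.
move=> Av ABk; have := qform_le_specnorm (A - B) v; rewrite qformB.
have := ler_wpM2r (sqr_ge0 (enorm v)) ABk; lra.
Qed.

End EuclideanGeometry.

(** * Second-order estimates along segments *)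

Section CalculusAlongLines.
Variables (R : realType) (n : nat) (f : 'cV[R]_n -> R).
Implicit Types (x v w : 'cV[R]_n) (A : 'M[R]_n) (t k : R).

Lemma derive_gradient x v :
  differentiable f x -> 'D_v f x = dotv (gradient f x) v.
Proof.
move=> df; rewrite deriveE// dotvE.
have -> : v = \sum_i v i 0 *: delta_mx i 0.
  apply/matrixP => i j; rewrite ord1 summxE (bigD1 i)//= !mxE !eqxx mulr1.
  by rewrite big1 ?addr0// => k /negPf ki; rewrite !mxE eq_sym ki mulr0.
rewrite linear_sum /=; apply: eq_bigr => i _; rewrite linearZ /= mxE deriveE//.
rewrite mulrC; congr (_ * _); rewrite summxE (bigD1 i)//= !mxE !eqxx mulr1.
by rewrite big1 ?addr0// => k /negPf ki; rewrite !mxE eq_sym ki mulr0.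
Qed.

Lemma derive_line (g : 'cV[R]_n -> R) x v t :
  differentiable g (x + t *: v) ->
  is_derive t 1 (fun s => g (x + s *: v)) ('D_v g (x + t *: v)).
Proof.
move=> dg; have := @diff_derivable _ _ _ _ _ v dg.
(* The difference quotient of s |-> g (x + s v) at t is literally that of g
   at x + t v in the direction v. *)
have E : (fun h : R => h^-1 *: (((fun s => g (x + s *: v)) \o shift t) (h *: 1)
           - g (x + t *: v))) =
         (fun h => h^-1 *: ((g \o shift (x + t *: v)) (h *: v)
           - g (x + t *: v))).
  apply/funext => h /=; rewrite [h *: 1]mulr1 scalerDl.
  by rewrite addrCA.
rewrite /derivable -E => dg'; split; first exact: dg'.
by rewrite /derive E.
Qed.

End CalculusAlongLines.

Section SecondOrder.
Variables (R : realType) (n : nat) (f : 'cV[R]_n -> R).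
Hypothesis f_diff : forall x, differentiable f x.
Hypothesis gradient_diff : forall x, differentiable (gradient f) x.
Implicit Types (x v w : 'cV[R]_n) (A : 'M[R]_n) (t k : R).

Lemma derive_line_dot_gradient w x v t :
  is_derive t 1 (fun s => dotv w (gradient f (x + s *: v)))
    (dotv w (hessian f (x + t *: v) *m v)).
Proof.
have -> : (fun s => dotv w (gradient f (x + s *: v))) =
          \sum_i (w i 0 *: (fun s => gradient f (x + s *: v) i 0)).
  by apply/funext => s; rewrite dotvE fct_sumE; apply: eq_bigr.
rewrite dotvE; apply: is_derive_sum => i; apply: is_deriveZ.
have di : differentiable (fun y => gradient f y i 0) (x + t *: v).
  exact: (differentiable_comp (gradient_diff _) (differentiable_coord _ _ _)).
apply: is_derive_eq (derive_line di) _.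
rewrite derive_gradient// dotvE mxE; apply: eq_bigr => j _.
by rewrite !mxE.
Qed.

(** The mean value theorem has no vector-valued form; testing the gradient
    against a fixed vector w is enough for all the estimates below, with w
    the very difference to be bounded. *)
Lemma gradient_mean_value w x v : exists2 t, 0 <= t <= 1 &
  dotv w (gradient f (x + v) - gradient f x) =
  dotv w (hessian f (x + t *: v) *m v).
Proof.
have d t := derive_line_dot_gradient w x v t.
have [|t] := @MVT_segment R _ _ 0 1 ler01 (fun t _ => d t).
  by apply: derivable_within_continuous => t _; case: (d t).
rewrite in_itv /= => t01; rewrite scale1r scale0r addr0 subr0 mulr1 => E.
by exists t; rewrite // dotvBr E.
Qed.

Lemma gradient_linearization A x v k :
  (forall t, 0 <= t <= 1 -> specnorm (hessian f (x + t *: v) - A) <= k) ->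
  enorm (gradient f (x + v) - gradient f x - A *m v) <= k * enorm v.
Proof.
move=> Ak; set w := _ - A *m v.
have [t /Ak tk E] := gradient_mean_value w x v.
have [->|w0] := eqVneq w 0.
  rewrite enorm0 mulr_ge0 ?enorm_ge0// (le_trans _ tk)//.
  exact: specnorm_ge0.
rewrite -(@ler_pM2l _ (enorm w)) ?enorm_gt0// -expr2 enorm_sqr.
rewrite {2}/w dotvBr E -dotvBr -mulmxBl (le_trans (cauchy_schwarz _ _))//.
rewrite ler_wpM2l ?enorm_ge0// (le_trans (enorm_mulmx _ _))//.
by rewrite ler_wpM2r ?enorm_ge0.
Qed.

(** The derivative in t of f(x + t v) - t g(x).v - t^2 M / 2, where
    M = v.Av + k |v|^2, is nonpositive on [0,1] by the mean value theorem for
    the gradient; this gives the factor 1/2 that a first-order mean value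
    argument loses. *)
Lemma second_order_upper_bound A x v k :
  (forall t, 0 <= t <= 1 -> specnorm (hessian f (x + t *: v) - A) <= k) ->
  f (x + v) <= f x + dotv (gradient f x) v
               + (qform A v + k * enorm v ^+ 2) / 2.
Proof.
move=> Ak; set M := qform A v + _.
pose phi (s : R) := f (x + s *: v).
pose q : R -> R := dotv (gradient f x) v *: id + (M / 2) *: (id ^+ 2).
pose psi := phi - q.
pose dpsi t := dotv (gradient f (x + t *: v)) v -
   (dotv (gradient f x) v + M * t).
have d t : is_derive t 1 psi (dpsi t).
  have dphi : is_derive t 1 phi (dotv (gradient f (x + t *: v)) v).
    by apply: is_derive_eq (derive_line _) _ => //; rewrite derive_gradient.
  have dq : is_derive t 1 q (dotv (gradient f x) v + M * t).
    apply: is_deriveD.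
      by apply: is_derive_eq; rewrite [_ *: _]mulr1.
    apply: is_derive_eq; rewrite /GRing.scale /= expr1; lra.
  exact: (is_deriveB dphi dq).
have [|t] := @MVT_segment R psi dpsi 0 1 ler01 (fun t _ => d t).
  by apply: derivable_within_continuous => t _; case: (d t).
rewrite in_itv /= => /andP[t0 t1].
have -> : psi 1 = f (x + v) - (dotv (gradient f x) v + M / 2).
  by rewrite /psi /phi /q !fctE scale1r /GRing.scale /= expr1n !mulr1.
have -> : psi 0 = f x.
  rewrite /psi /phi /q !fctE scale0r addr0 /GRing.scale /= expr0n /=.
  by rewrite !mulr0 addr0 subr0.
rewrite subr0 mulr1 => E.
suff : dpsi t <= 0 by rewrite -E; lra.
have [s /andP[s0 s1] Es] := gradient_mean_value v x (t *: v).
rewrite /dpsi opprD addrA subr_le0 -dotvNl -dotvDl dotvC Es -scalemxAr.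
rewrite dotvZr mulrC ler_wpM2r//.
have /Ak st : 0 <= s * t <= 1 by rewrite mulr_ge0// mulr_ile1.
rewrite scalerA -lerBlDl -/(qform _ _) -qformB.
by rewrite (le_trans (qform_le_specnorm _ _))// ler_wpM2r ?sqr_ge0.
Qed.

(** Along the direction v of the gradient itself, f has derivative |v|^2 at x,
    so a single one-dimensional Fermat argument suffices. *)
Lemma gradient_local_minimizer x :
  (\forall y \near x, f x <= f y) -> gradient f x = 0.
Proof.
move=> /nbhs_ballP[e /= e0 xmin]; apply/eqP.
rewrite -enorm_eq0 -sqrf_eq0 enorm_sqr.
set v := gradient f x; apply/eqP.
have d t : is_derive t 1 (fun s => f (x + s *: v))
    (dotv (gradient f (x + t *: v)) v).
  by apply: is_derive_eq (derive_line _) _ => //; rewrite derive_gradient.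
(* Small enough for x + t v to stay in the ball of radius e when |t| < r. *)
pose r := e / (1 + `|v|).
have v1 : 0 < 1 + `|v| by rewrite ltr_pwDl.
have r0 : 0 < r by rewrite divr_gt0.
have [|t _|||_ <-] := @derive1_at_min R (fun s => f (x + s *: v)) (- r) r 0.
- lra.
- by case: (d t).
- by rewrite in_itv /=; lra.
- move=> t; rewrite in_itv /= => /andP[rt tr]; rewrite scale0r addr0.
  apply: xmin; rewrite -ball_normE /= opprD addrA subrr sub0r normrN normrZ.
  have : `|t| < r by rewrite ltr_norml rt.
  rewrite ltr_pdivlMr// mulrDr mulr1; have := normr_ge0 t; lra.
- by case: (d 0) => _ ->; rewrite scale0r addr0.
Qed.

(** The left-hand side is |H (x + p - xs)| for the exact Newton step
    p = - H^-1 g at x, where H and g are the Hessian and the gradient at x and H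
    is invertible: it is the error inherent in Newton's method. *)
Lemma newton_residual_le x xs k : gradient f xs = 0 ->
  (forall t, 0 <= t <= 1 ->
     specnorm (hessian f (x + t *: (xs - x)) - hessian f x) <= k) ->
  enorm (hessian f x *m (x - xs) - gradient f x) <= k * enorm (x - xs).
Proof.
move=> xs_critical /(gradient_linearization (v := xs - x)).
rewrite subrKC xs_critical sub0r -[xs - x]opprB mulmxN opprK enormN.
by rewrite [- _ + _]addrC.
Qed.

End SecondOrder.

(** * Outputs of the capped conjugate gradient method *)

Section CappedConjugateGradient.
Variables (R : realType) (n : nat) (H : 'M[R]_n) (g : 'cV[R]_n).
Variables (zeta sigma : R).

(** Each exit of type NC is guarded by the curvature test of the very vector
    that it returns. *)
Lemma capped_cg_NC_curvature d :
  capped_cg H g zeta sigma d NC -> low_curvature H sigma d.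
Proof.
rewrite /capped_cg; case: ifP => [low [-> _]//|_ [j [_ _]]].
rewrite /cg_returns; case: ifP => [low [-> _]//|_].
case: ifP => [_ [_]//|_]; case: ifP => [low [-> _]//|_].
by case: ifP => [_ [_ [i _ []]]//|].
Qed.

Lemma low_curvature_psd v :
  0 <= sigma -> 0 <= qform H v -> low_curvature H sigma v = false.
Proof.
move=> s0 Hv; apply/negbTE; rewrite /low_curvature -leNgt qform_damped.
by have := mulr_ge0 s0 (sqr_ge0 (enorm v)); lra.
Qed.

Lemma cg_iter_residual j :
  let s := cg_iter H g sigma j in cg_r s = damped H sigma *m cg_y s + g.
Proof.
elim: j => [|j /= IH]; first by rewrite /= mulmx0 add0r.
rewrite /cg_next_y {1}IH mulmxDr scalemxAr; set a := _ *m _; set b := _ *m _.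
by rewrite addrAC.
Qed.

(** Bounding H on the single vector y is what turns the stopping test,
    relative to |g|, into a bound relative to |y|. *)
Lemma cg_iter_norm_estimate j :
  let s := cg_iter H g sigma j in
  0 <= cg_U s /\ enorm (H *m cg_y s) <= cg_U s * enorm (cg_y s).
Proof.
elim: j => [|j /= [U0 _]]; first by rewrite /= mulmx0 !enorm0 mul0r.
rewrite !big_cons big_nil; set u := cg_next_y _ _ _.
set p := - _ + _ *: _; set r := cg_r _ + _ *: _ in p *.
set m1 := if r != 0 then _ else _; set m2 := if u != 0 then _ else _.
have m1U : 0 <= m1 by rewrite /m1; case: ifP => // _; rewrite le_max U0 orbT.
have [m2U m2u] : 0 <= m2 /\ enorm (H *m u) <= m2 * enorm u.
  rewrite /m2; case: ifPn => [u0|].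
    by rewrite le_max m1U orbT -ler_pdivrMr ?enorm_gt0// le_max lexx.
  by rewrite negbK => /eqP ->; rewrite mulmx0 enorm0 mulr0.
set m3 := if p != 0 then _ else _; set m4 := if - g != 0 then _ else _.
suff m24 : m2 <= m4.
  by rewrite (le_trans m2U)// (le_trans m2u)// ler_wpM2r// enorm_ge0.
have m23 : m2 <= m3 by rewrite /m3; case: ifP => // _; rewrite le_max lexx orbT.
by rewrite /m4; case: ifP => // _; rewrite le_max m23 orbT.
Qed.

(** The test reads |r| <= zeta sigma |g| / (3 (U + 2 sigma)).  Dropping U >= 0
    gives the first bound.  For the second, g = r - (H + 2 sigma) d and
    |H d| <= U |d| give |g| <= (U + 2 sigma) |d| + |r|, where |r| <= |g| / 12
    by the first bound and zeta <= 1/2, so that the factor U + 2 sigma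
    cancels. *)
Lemma capped_cg_SOL_residual d : g != 0 -> 0 < sigma -> 0 < zeta <= 1 / 2 ->
  capped_cg H g zeta sigma d SOL ->
  [/\ enorm (damped H sigma *m d + g) <= zeta / 6 * enorm g,
      enorm (damped H sigma *m d + g) <= sigma / 4 * enorm d & d != 0].
Proof.
move=> g0 s0 /andP[z0 z2]; rewrite /capped_cg.
case: ifP => [_ []//|_ [j [_ _]]].
have := cg_iter_residual j; have := cg_iter_norm_estimate j.
rewrite /cg_returns; set s := cg_iter _ _ _ _ => /= -[U0 Uy] Er.
case: ifP => [_ []//|_]; case: ifP => [small [-> _]|_]; last first.
  by case: ifP => [_ []//|_]; case: ifP => [_ []|].
move: small; rewrite /cg_small_residual -Er.
set y := cg_y s in Uy Er *; set U := cg_U s in U0 Uy *; set r := cg_r s in Er *.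
rewrite /cg_zeta /cg_kappa.
have -> : zeta / (3 * ((U + 2 * sigma) / sigma)) =
          zeta * sigma / (3 * (U + 2 * sigma)) by field; lra.
rewrite mulrAC ler_pdivlMr; last lra.
move=> small; have r0 := enorm_ge0 r; have y0 := enorm_ge0 y.
have gpos : 0 < enorm g by rewrite enorm_gt0.
have r6 : enorm r <= zeta / 6 * enorm g.
  rewrite -(ler_pM2r (_ : 0 < 6 * sigma)); last lra.
  by have := mulr_ge0 r0 U0; nra.
have gy : enorm g <= (U + 2 * sigma) * enorm y + enorm r.
  have -> : g = r - (H *m y + (2 * sigma) *: y).
    by rewrite Er mul_damped addrC addKr.
  rewrite [leRHS]addrC; apply: le_trans (enorm_sub _ _) _; rewrite lerD2l.
  apply: le_trans (enormD _ _) _; rewrite [leRHS]mulrDl lerD//.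
  by rewrite enormZ ger0_norm//; lra.
have r4 : enorm r <= sigma / 4 * enorm y.
  rewrite -(ler_pM2r (_ : 0 < 3 * (U + 2 * sigma))); last lra.
  apply: (le_trans small).
  have h1 : zeta * enorm g <= enorm g / 2.
    by have := ler_wpM2r (ltW gpos) z2; lra.
  have h2 : enorm g * 11 / 12 <= (U + 2 * sigma) * enorm y by lra.
  have h3 : sigma * (zeta * enorm g)
            <= sigma * (6 / 11 * ((U + 2 * sigma) * enorm y)).
    by rewrite ler_pM2l//; lra.
  have : 0 <= sigma * ((U + 2 * sigma) * enorm y) by rewrite !mulr_ge0//; lra.
  lra.
split=> //; apply: contraTneq gpos => y00; rewrite -leNgt.
move: gy r4; rewrite y00 enorm0 !mulr0; lra.
Qed.

End CappedConjugateGradient.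

(** * The damped Newton step near a nondegenerate critical point *)

Section CriticalBall.
Variables (R : realType) (n : nat) (f : 'cV[R]_n -> R).
Variables (xs : 'cV[R]_n) (mu delta : R).
Hypothesis f_diff : forall x, differentiable f x.
Hypothesis gradient_diff : forall x, differentiable (gradient f) x.
Hypothesis mu_gt0 : 0 < mu.
Hypothesis xs_critical : gradient f xs = 0.
Hypothesis xs_mu : loewner_ge (hessian f xs) mu%:M.
Hypothesis hessian_osc : forall x y, cball xs delta x -> cball xs delta y ->
  specnorm (hessian f y - hessian f x) <= mu / 8.
Implicit Types (x y v d : 'cV[R]_n).

Let e x := enorm (x - xs).
Let g x := enorm (gradient f x).
Let L := specnorm (hessian f xs) + mu / 8.

Lemma cball_segment x v t : cball xs delta x -> cball xs delta (x + v) ->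
  0 <= t <= 1 -> cball xs delta (x + t *: v).
Proof.
rewrite /cball /= => xb vb /andP[t0 t1].
have -> : x + t *: v - xs = t *: (x + v - xs) + (1 - t) *: (x - xs).
  by apply/matrixP => i j; rewrite !mxE; ring.
apply: le_trans (enormD _ _) _; rewrite !enormZ !ger0_norm ?subr_ge0//.
by have := ler_wpM2l t0 vb; have := ler_wpM2l (_ : 0 <= 1 - t) xb; nra.
Qed.

Lemma cball_center x : cball xs delta x -> cball xs delta xs.
Proof. by apply: le_trans; rewrite subrr enorm0 enorm_ge0. Qed.

Lemma hessian_osc_segment x y t : cball xs delta x -> cball xs delta y ->
  0 <= t <= 1 ->
  specnorm (hessian f (x + t *: (y - x)) - hessian f x) <= mu / 8.
Proof.
move=> xb yb t01; apply: hessian_osc => //; apply: cball_segment => //.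
by rewrite subrKC.
Qed.

Lemma hessian_coercive x v : cball xs delta x ->
  mu / 2 * enorm v ^+ 2 <= qform (hessian f x) v.
Proof.
move=> xb; have xs_coer := xs_mu v; rewrite qform_scalar in xs_coer.
have osc := hessian_osc xb (cball_center xb).
apply: le_trans (coercive_perturbation xs_coer osc).
by rewrite ler_wpM2r ?sqr_ge0//; have := mu_gt0; lra.
Qed.

Lemma newton_residual x : cball xs delta x ->
  enorm (hessian f x *m (x - xs) - gradient f x) <= mu / 8 * e x.
Proof.
move=> xb; apply: newton_residual_le => // t t01.
exact: hessian_osc_segment (cball_center xb) t01.
Qed.

Lemma gradient_lipschitz x : cball xs delta x -> g x <= L * e x.
Proof.
move=> xb; have xsb := cball_center xb.
have := @gradient_linearization _ _ _ gradient_diff (hessian f xs) xs (x - xs) _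
  (fun t => @hessian_osc_segment xs x t xsb xb).
rewrite subrKC xs_critical subr0 => lin; rewrite /g.
rewrite -[gradient f x](subrK (hessian f xs *m (x - xs))).
apply: le_trans (enormD _ _) _; rewrite /L mulrDl addrC lerD//.
exact: enorm_mulmx.
Qed.

Lemma critical_point_unique x : cball xs delta x -> gradient f x = 0 -> x = xs.
Proof.
move=> xb gx0; have := newton_residual xb; rewrite gx0 subr0.
have := coercive_enorm_le (hessian_coercive (x - xs) xb).
have := enorm_ge0 (x - xs); rewrite -/(e x) => e0 h1 h2.
have /eqP : e x = 0.
  by apply/eqP; rewrite eq_le e0 andbT -(pmulr_rle0 _ mu_gt0); lra.
by rewrite enorm_eq0 subr_eq0 => /eqP.
Qed.

Section DampedNewtonStep.
Variables (x d : 'cV[R]_n) (sigma : R).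
Hypothesis x_ball : cball xs delta x.
Hypothesis sigma_gt0 : 0 < sigma.
Let r := damped (hessian f x) sigma *m d + gradient f x.

(** Apply H + 2 sigma to x + d - xs: the result is
    2 sigma (x - xs) + (H (x - xs) - g) + r, and H + 2 sigma is bounded below
    by mu / 2 + 2 sigma. *)
Lemma damped_step_error :
  (2 * sigma + mu / 2) * e (x + d)
  <= 2 * sigma * e x + enorm (hessian f x *m (x - xs) - gradient f x) + enorm r.
Proof.
set h := hessian f x; set gr := gradient f x.
have -> : e (x + d) = enorm (x - xs + d) by rewrite /e addrAC.
have coer : (2 * sigma + mu / 2) * enorm (x - xs + d) ^+ 2
            <= qform (damped h sigma) (x - xs + d).
  rewrite qform_damped; have := hessian_coercive (x - xs + d) x_ball.
  by rewrite -/h; lra.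
apply: le_trans (coercive_enorm_le coer) _.
have -> : damped h sigma *m (x - xs + d) =
          (2 * sigma) *: (x - xs) + (h *m (x - xs) - gr) + r.
  rewrite mulmxDr mul_damped /r -/gr -/h.
  by apply/matrixP => i j; rewrite !mxE; ring.
apply: le_trans (enormD _ _) _; rewrite lerD2r.
apply: le_trans (enormD _ _) _; rewrite lerD2r enormZ [in leLHS]ger0_norm.
  exact: lexx.
by rewrite mulr_ge0 ?ltW.
Qed.

Hypothesis xd_ball : cball xs delta (x + d).
Hypothesis r_small : enorm r <= sigma / 4 * enorm d.

Let osc t : 0 <= t <= 1 ->
  specnorm (hessian f (x + t *: d) - hessian f x) <= mu / 8.
Proof.
by move=> t01; apply: hessian_osc => //; exact: cball_segment.
Qed.

(** Here - g.d = d.Hd + 2 sigma |d|^2 - r.d.  The second-order bound on f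
    consumes half of d.Hd, and the other half, at least (mu / 4) |d|^2, absorbs
    the variation of the Hessian; the residual costs at most
    (sigma / 4) |d|^2. *)
Lemma damped_step_decrease :
  7 / 4 * sigma * enorm d ^+ 2 <= f x - f (x + d).
Proof.
have ub := second_order_upper_bound f_diff gradient_diff osc.
have gd : dotv (gradient f x) d =
    dotv r d - qform (hessian f x) d - 2 * sigma * enorm d ^+ 2.
  rewrite -addrA -opprD -qform_damped /qform [dotv d _]dotvC -dotvNl -dotvDl.
  by rewrite /r addrAC subrr add0r.
have rd : dotv r d <= sigma / 4 * enorm d ^+ 2.
  apply: le_trans (cauchy_schwarz _ _) _.
  by rewrite expr2 mulrA ler_wpM2r// enorm_ge0.
have := hessian_coercive d x_ball.
have := mulr_ge0 (ltW mu_gt0) (sqr_ge0 (enorm d)); lra.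
Qed.

(** To first order the new gradient is g + H d = r - 2 sigma d.  The
    linearization error (mu / 8) |d| is controlled by |g| since
    (mu / 2) |d| <= |(H + 2 sigma) d| = |r - g| <= (13 / 12) |g|; altogether
    1 / 12 + 13 / 48 = 17 / 48. *)
Lemma damped_step_gradient : enorm r <= g x / 12 ->
  g (x + d) <= 17 / 48 * g x + 2 * sigma * enorm d.
Proof.
move=> r12.
have lin := gradient_linearization gradient_diff osc.
have gr : g (x + d) <= mu / 8 * enorm d + (enorm r + 2 * sigma * enorm d).
  rewrite /g -[gradient f (x + d)](subrK (r - (2 * sigma) *: d)).
  apply: le_trans (enormD _ _) _; apply: lerD.
    rewrite [X in enorm X](_ : _ = 
      gradient f (x + d) - gradient f x - hessian f x *m d)//.
    by rewrite /r mul_damped; apply/matrixP => i j; rewrite !mxE; ring.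
  apply: le_trans (enorm_sub _ _) _.
  by rewrite enormZ [`|_ * _|]ger0_norm ?lexx// mulr_ge0 ?ltW.
have dg : mu / 2 * enorm d <= 13 / 12 * g x.
  have coer : mu / 2 * enorm d ^+ 2 <= qform (damped (hessian f x) sigma) d.
    rewrite qform_damped; apply: le_trans (hessian_coercive d x_ball) _.
    by rewrite lerDl mulr_ge0 ?sqr_ge0// mulr_ge0// ltW.
  apply: le_trans (coercive_enorm_le coer) _.
  rewrite -[leLHS](congr1 _ (addrK (gradient f x) _)).
  apply: le_trans (enorm_sub (damped (hessian f x) sigma *m d + gradient f x)
    (gradient f x)) _.
  rewrite -/r -/(g x); lra.
lra.
Qed.

End DampedNewtonStep.

End CriticalBall.

(** * One iteration near the minimizer *)

Lemma powR_three_halves (R : realType) (a : R) :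
  0 <= a -> a `^ (3 / 2) = a * Num.sqrt a.
Proof.
move=> a0; have -> : 3 / 2 = 1 + 2^-1 :> R by lra.
by rewrite powRD ?powRr1 ?powR12_sqrt//; apply/implyP => /eqP; lra.
Qed.

(** With a = sqrt gamma, b = sqrt |g| and D = |d|, the damping is sigma = a b.
    A step that fails to halve the gradient satisfies sigma D >= (7/96) |g|,
    so its decrease is at least (7/4) (7/96)^2 |g|^2 / sigma, whereas the
    threshold is at most |g|^2 / (400 sigma). *)
Lemma decrease_above_threshold (R : realType) (a b D c dec : R) :
  0 < a -> 0 < b -> 0 <= D -> c <= 1 / 400 ->
  b ^+ 2 / 2 <= 17 / 48 * b ^+ 2 + 2 * (a * b) * D ->
  7 / 4 * (a * b) * D ^+ 2 <= dec ->
  c * a^-1 * (b ^+ 2 * b) <= dec.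
Proof.
move=> a0 b0 D0 c0 h1 h2; have s0 : 0 < a * b by rewrite mulr_gt0.
apply: le_trans h2; rewrite -(ler_pM2l s0).
have -> : a * b * (c * a^-1 * (b ^+ 2 * b)) = c * b ^+ 2 ^+ 2.
  by field; rewrite gt_eqF.
have h3 : 7 / 96 * b ^+ 2 <= a * b * D by lra.
have h4 : (7 / 96 * b ^+ 2) ^+ 2 <= (a * b * D) ^+ 2.
  by rewrite ler_sqr ?nnegrE//; rewrite mulr_ge0 ?sqr_ge0 ?(ltW s0)//; lra.
have h5 : c * b ^+ 2 ^+ 2 <= 1 / 400 * b ^+ 2 ^+ 2.
  by rewrite ler_wpM2r ?sqr_ge0.
have b4 := sqr_ge0 (b ^+ 2).
have -> : a * b * (7 / 4 * (a * b) * D ^+ 2) = 7 / 4 * (a * b * D) ^+ 2 by ring.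
rewrite exprMn in h4.
move: (b ^+ 2 ^+ 2) ((a * b * D) ^+ 2) h4 h5 b4 => u w; lra.
Qed.

Lemma c_sol_le (R : realType) (eta theta : R) :
  0 < eta <= 1 / 2 -> 0 < theta < 1 -> c_sol eta theta <= 1 / 400.
Proof.
move=> /andP[e0 e2] /andP[t0 t1]; have p0 : 0 <= 1 - eta by lra.
have p1 : eta * (1 - eta) <= 1 by apply: mulr_ile1; lra.
have p2 : eta * (1 - eta) * theta <= 1.
  apply: mulr_ile1 => //; [exact: mulr_ge0 (ltW e0) p0|exact: ltW|exact: ltW].
by rewrite /c_sol; lra.
Qed.

Section AlgorithmNearMinimizer.
Variables (R : realType) (n : nat) (f : 'cV[R]_n -> R).
Variables (xs : 'cV[R]_n) (eta theta mu delta : R).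
Hypothesis f_diff : forall x, differentiable f x.
Hypothesis gradient_diff : forall x, differentiable (gradient f) x.
Hypothesis eta_range : 0 < eta <= 1 / 2.
Hypothesis theta_range : 0 < theta < 1.
Hypothesis mu_gt0 : 0 < mu.
Hypothesis xs_critical : gradient f xs = 0.
Hypothesis xs_mu : loewner_ge (hessian f xs) mu%:M.
Hypothesis hessian_osc : forall x y, cball xs delta x -> cball xs delta y ->
  specnorm (hessian f y - hessian f x) <= mu / 8.
Let L := specnorm (hessian f xs) + mu / 8.
Hypothesis delta_small : L * Num.sqrt (L * delta) <= 3 / 4 * mu.

(** The accuracy zeta <= sqrt |g| makes the residual of order |g|^(3/2), hence
    negligible against the error on a small ball; the smallness required does
    not involve sigma. *)
Lemma residual_le_error x : cball xs delta x ->
  enorm (gradient f x) * Num.sqrt (enorm (gradient f x)) / 6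
  <= mu / 8 * enorm (x - xs).
Proof.
move=> xb.
have gL := gradient_lipschitz gradient_diff xs_critical hessian_osc xb.
have L0 : 0 <= L by rewrite addr_ge0 ?specnorm_ge0// divr_ge0// ltW.
have e0 := enorm_ge0 (x - xs).
have sq : Num.sqrt (enorm (gradient f x)) <= Num.sqrt (L * delta).
  by rewrite ler_wsqrtr// (le_trans gL)// ler_wpM2l.
have h := ler_pM (enorm_ge0 _) (sqrtr_ge0 _) gL sq.
have h' := ler_wpM2r e0 delta_small.
rewrite -[specnorm _ + _]/L in h.
move: (enorm (gradient f x) * _) h => u h; lra.
Qed.

(** The decisive point is that gamma is not bounded from above: even for a huge
    damping parameter the unit step is accepted, it does not increase the
    distance to the minimizer, and it never triggers the doubling of gamma. *)
Lemma algorithm_step_near_minimizer x gam x' gam' :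
  cball xs delta x -> gradient f x != 0 -> 0 < gam ->
  algorithm_step f eta theta x gam x' gam' ->
  let sigma := Num.sqrt (gam * enorm (gradient f x)) in
  [/\ gam' = gam, f x' <= f x,
      (2 * sigma + mu / 2) * enorm (x' - xs)
        <= (2 * sigma + mu / 4) * enorm (x - xs)
    & (2 * sigma + mu / 2) * enorm (x' - xs)
        <= 2 * sigma * enorm (x - xs)
           + enorm (hessian f x *m (x - xs) - gradient f x)
           + enorm (gradient f x) * Num.sqrt (enorm (gradient f x)) / 6].
Proof.
move=> xb g0 gam0 [d [t [cg step]]] sigma; set G := enorm (gradient f x).
have G0 : 0 < G by rewrite enorm_gt0.
have s0 : 0 < sigma by rewrite sqrtr_gt0 mulr_gt0.
case: t cg step => cg step; last first.
  have := capped_cg_NC_curvature cg; rewrite low_curvature_psd// ?(ltW s0)//.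
  apply: le_trans (hessian_coercive mu_gt0 xs_mu hessian_osc d xb).
  by rewrite mulr_ge0 ?sqr_ge0// divr_ge0// ltW.
set zeta := Num.min _ _ in cg.
have zeta_range : 0 < zeta <= 1 / 2.
  by rewrite /zeta lt_min ge_min lexx sqrtr_gt0 G0 andbT; lra.
have [] := capped_cg_SOL_residual g0 s0 zeta_range cg.
rewrite -/G; set r := _ + _ => r_zeta r_d d0.
have D0 : 0 < enorm d by rewrite enorm_gt0.
have r_sqrt : enorm r <= G * Num.sqrt G / 6.
  have : zeta <= Num.sqrt G by rewrite /zeta ge_min lexx orbT.
  by move=> /(ler_wpM2r (ltW G0)); lra.
have r_G : enorm r <= G / 12.
  by have /andP[_ /(ler_wpM2r (ltW G0))] := zeta_range; lra.
have err := damped_step_error mu_gt0 xs_mu hessian_osc d xb s0.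
rewrite -/r -/sigma in err.
have err_rate := le_trans err (lerD (lexx _) r_sqrt).
have contr : (2 * sigma + mu / 2) * enorm (x + d - xs)
             <= (2 * sigma + mu / 4) * enorm (x - xs).
  apply: le_trans err_rate _.
  have := residual_le_error xb.
  have := newton_residual gradient_diff xs_critical hessian_osc xb.
  rewrite -/G; move: (enorm _) (enorm _) (G * _) => u v w; lra.
have xdb : cball xs delta (x + d).
  apply: le_trans xb; rewrite -(@ler_pM2l _ (2 * sigma + mu / 2)).
    apply: (le_trans contr); rewrite ler_wpM2r ?enorm_ge0//.
    have := mu_gt0; lra.
  have := mu_gt0; lra.
have dec := damped_step_decrease f_diff gradient_diff mu_gt0 xs_mu hessian_osc
  xb xdb r_d.
have grad := damped_step_gradient gradient_diff mu_gt0 xs_mu hessian_osc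
  xb s0 xdb r_G.
have D20 : 0 < sigma * enorm d ^+ 2 by rewrite mulr_gt0// exprn_gt0.
have armijo i : i = 0%N -> f (x + theta ^+ i *: d) <
    f x - eta * sigma * theta ^+ i * enorm d ^+ 2.
  move=> ->; rewrite expr0 scale1r mulr1 -mulrA.
  have /andP[_ /(ler_wpM2r (ltW D20))] := eta_range; lra.
case: step => alpha [Ealpha -> ->].
(* Both branches of the line search end with the unit step. *)
have -> : alpha = 1.
  move: Ealpha; case: ifP => // _ [[//|j] [_ least] ->].
  by have := least 0%N isT; rewrite armijo.
rewrite scale1r -/G; split => //; last first.
  by rewrite -subr_ge0; apply: le_trans dec; lra.
case: ifPn => // /andP[half]; rewrite ltNge => /negP[].
rewrite powR_three_halves ?(ltW G0)// powRN div1r powR12_sqrt ?(ltW gam0)//.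
rewrite -{1}(sqr_sqrtr (ltW G0)).
apply: (decrease_above_threshold (D := enorm d)) => //.
- by rewrite (sqrtr_gt0 gam).
- by rewrite (sqrtr_gt0 G).
- exact: ltW.
- exact: c_sol_le eta_range theta_range.
- rewrite -sqrtrM ?(ltW gam0)// sqr_sqrtr ?(ltW G0)//.
  exact: (le_trans (ltW half)).
- by rewrite -sqrtrM ?(ltW gam0).
Qed.

End AlgorithmNearMinimizer.

(** * The generated sequence *)

Section Iterates.
Variables (R : realType) (n : nat) (f : 'cV[R]_n -> R).
Variables (x0 : 'cV[R]_n) (gamma0 eta theta : R).
Hypothesis gamma0_ge1 : 1 <= gamma0.
Hypothesis eta_ge0 : 0 <= eta.
Hypothesis theta_ge0 : 0 <= theta.

Lemma algorithm_step_monotone x gam x' gam' : 0 <= gam ->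
  algorithm_step f eta theta x gam x' gam' -> f x' <= f x /\ gam <= gam'.
Proof.
move=> gam0 [d [t [_]]].
have gam2 (b : bool) : gam <= if b then 2 * gam else gam.
  by case: b => //; lra.
case: t => -[alpha [Ealpha -> ->]]; (split; last exact: gam2).
  move: Ealpha; case: ifP => [/andP[fd _] ->|_ [j [lej _] ->]].
    by rewrite scale1r.
  apply: le_trans (ltW lej) _.
  by rewrite gerBl !mulr_ge0 ?sqrtr_ge0 ?exprn_ge0 ?enorm_ge0.
case: Ealpha => j [lej _] ->; apply: le_trans (ltW lej) _.
by rewrite gerBl !mulr_ge0 ?exprn_ge0 ?enorm_ge0// invr_ge0.
Qed.

Variables (x : nat -> 'cV[R]_n) (gam : nat -> R).

Lemma generatedW j k : (j <= k)%N ->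
  generated f x0 gamma0 eta theta x gam k ->
  generated f x0 gamma0 eta theta x gam j.
Proof.
move=> jk [x0E gam0E steps]; split=> // i ij.
exact/steps/(leq_trans ij).
Qed.

Lemma generated_monotone k : generated f x0 gamma0 eta theta x gam k ->
  f (x k) <= f x0 /\ 1 <= gam k.
Proof.
elim: k => [[-> -> _]//|k IH gen].
have [fk gk] := IH (generatedW (leqnSn k) gen).
have [_ _ /(_ k (leqnn _))[_ step]] := gen.
have [|f1 g1] := algorithm_step_monotone _ step; first lra.
by split; [exact: le_trans f1 fk|exact: le_trans gk g1].
Qed.

End Iterates.

Lemma specnorm_continuous_osc (R : realType) (n : nat)
    (H : 'cV[R]_n -> 'M[R]_n) (a : 'cV[R]_n) (k : R) :
  continuous H -> 0 < k -> exists2 r, 0 < r &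
  forall x y, cball a r x -> cball a r y -> specnorm (H y - H x) <= k.
Proof.
(* The factor n of specnorm_le_mxnorm is replaced by 1 + n to cover n = 0. *)
move=> H_cont k0; pose e := k / (2 * (1 + n%:R)).
have n0 : 0 <= n%:R :> R by [].
have e0 : 0 < e by rewrite divr_gt0//; lra.
have /cvgrPdist_lt /(_ e e0) /nbhs_ballP[r /= r0 near_a] := H_cont a.
exists (r / 2) => [|x y]; first by rewrite divr_gt0.
have near_cball z : cball a (r / 2) z -> `|H a - H z| < e.
  move=> za; apply: near_a; rewrite -ball_normE /= -normrN opprB.
  by rewrite (le_lt_trans (mxnorm_le_enorm _))// (le_lt_trans za)//; lra.
move=> /near_cball xa /near_cball ya.
apply: le_trans (specnorm_le_mxnorm _) _.
have : `|H y - H x| <= 2 * e.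
  rewrite (_ : H y - H x = (H a - H x) - (H a - H y)).
    by rewrite (le_trans (ler_normB _ _))//; lra.
  by rewrite opprB [RHS]addrC subrKA.
move/(ler_wpM2l n0)/le_trans; apply.
rewrite /e.
have -> : n%:R * (2 * (k / (2 * (1 + n%:R)))) = k * (n%:R / (1 + n%:R)).
  by field; lra.
by rewrite ler_piMr ?(ltW k0)// ler_pdivrMr; lra.
Qed.

Section LocalConvergence.
Variables (R : realType) (n : nat) (f : 'cV[R]_n -> R).
Variables (x0 : 'cV[R]_n) (gamma0 eta theta : R) (Ug UH nu Hf : R).
Variables (xs : 'cV[R]_n) (mu delta : R).
Hypothesis f_diff : forall x, differentiable f x.
Hypothesis gradient_diff : forall x, differentiable (gradient f) x.
Hypothesis gamma0_ge1 : 1 <= gamma0.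
Hypothesis eta_range : 0 < eta <= 1 / 2.
Hypothesis theta_range : 0 < theta < 1.
Hypothesis mu_gt0 : 0 < mu.
Hypothesis xs_critical : gradient f xs = 0.
Hypothesis xs_mu : loewner_ge (hessian f xs) mu%:M.
Hypothesis delta_ge0 : 0 <= delta.
Hypothesis delta_le1 : delta <= 1.
Hypothesis hessian_osc : forall x y, cball xs delta x -> cball xs delta y ->
  specnorm (hessian f y - hessian f x) <= mu / 8.
Let L := specnorm (hessian f xs) + mu / 8.
Hypothesis delta_small : L * Num.sqrt (L * delta) <= 3 / 4 * mu.

Variables (x : nat -> 'cV[R]_n) (gam : nat -> R) (k0 : nat).
Hypothesis xk0_ball : cball xs delta (x k0).
Let gen k := generated f x0 gamma0 eta theta x gam k.
Let err k := enorm (x k - xs).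
Let sigma k := Num.sqrt (gam k0 * enorm (gradient f (x k))).

Let L_ge0 : 0 <= L.
Proof. by rewrite addr_ge0 ?specnorm_ge0// divr_ge0// ltW. Qed.

Let gam_gt0 k : gen k -> 0 < gam k.
Proof.
have /andP[e0 _] := eta_range; have /andP[t0 _] := theta_range.
by case/(generated_monotone gamma0_ge1 (ltW e0) (ltW t0)) => _; lra.
Qed.

Lemma iterates_stay k : (k0 <= k)%N -> gen k ->
  [/\ cball xs delta (x k), gam k = gam k0 & f (x k) <= f (x k0)].
Proof.
move=> /subnKC <-; elim: (k - k0)%N => [|m IH]; first by rewrite addn0.
rewrite addnS => genS; have genm := generatedW (leqnSn _) genS.
have [xb gamE fm] := IH genm.
have [_ _ /(_ _ (leqnn _))[g0 step]] := genS.
have [-> fS contr _] := algorithm_step_near_minimizer f_diff gradient_diff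
  eta_range theta_range mu_gt0 xs_critical xs_mu hessian_osc delta_small xb g0
  (gam_gt0 genm) step.
split=> //; last exact: le_trans fS fm.
set s := Num.sqrt _ in contr; have s0 : 0 <= s by exact: sqrtr_ge0.
apply: le_trans xb; have mu0 := mu_gt0.
rewrite -(@ler_pM2l _ (2 * s + mu / 2)); last lra.
by apply: (le_trans contr); rewrite ler_wpM2r ?enorm_ge0//; lra.
Qed.

Lemma iterate_step k : (k0 <= k)%N -> gen k.+1 ->
  (2 * sigma k + mu / 2) * err k.+1 <= (2 * sigma k + mu / 4) * err k /\
  (2 * sigma k + mu / 2) * err k.+1 <= 2 * sigma k * err k
     + enorm (hessian f (x k) *m (x k - xs) - gradient f (x k))
     + enorm (gradient f (x k)) * Num.sqrt (enorm (gradient f (x k))) / 6.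
Proof.
move=> kk genS; have genk := generatedW (leqnSn _) genS.
have [xb gamE _] := iterates_stay kk genk.
have [_ _ /(_ _ (leqnn _))[g0 step]] := genS.
have := algorithm_step_near_minimizer f_diff gradient_diff
  eta_range theta_range mu_gt0 xs_critical xs_mu hessian_osc delta_small xb g0
  (gam_gt0 genk) step.
by rewrite /= gamE => -[].
Qed.

(** Since gamma is frozen and the gradient is bounded by L delta on the ball,
    all dampings are at most s, so the error contracts by the fixed ratio
    (2 s + mu / 4) / (2 s + mu / 2). *)
Lemma iterates_cvg : (forall k, gen k) -> x k @[k --> \oo] --> xs.
Proof.
move=> genk; pose s := Num.sqrt (gam k0 * (L * delta)).
pose rho := (2 * s + mu / 4) / (2 * s + mu / 2).
have mu0 := mu_gt0; have s0 : 0 <= s by exact: sqrtr_ge0.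
have den0 : 0 < 2 * s + mu / 2 by lra.
have rho0 : 0 <= rho by rewrite divr_ge0//; lra.
have contr m : err (k0 + m) <= rho ^+ m * delta.
  elim: m => [|m IH]; first by rewrite addn0 expr0 mul1r.
  have [xb gamE _] := iterates_stay (leq_addr m k0) (genk _).
  have [step _] := iterate_step (leq_addr m k0) (genk _).
  have ss : sigma (k0 + m)%N <= s.
    rewrite ler_wsqrtr// ler_wpM2l// ?(ltW (gam_gt0 _))//.
    have := gradient_lipschitz gradient_diff xs_critical hessian_osc xb.
    by move/le_trans; apply; rewrite ler_wpM2l.
  have e0 := enorm_ge0 (x (k0 + m)%N - xs); rewrite -/(err _) in e0.
  have sig0 : 0 <= sigma (k0 + m)%N by exact: sqrtr_ge0.
  have dec : err (k0 + m)%N.+1 <= err (k0 + m)%N.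
    rewrite -(@ler_pM2l _ (2 * sigma (k0 + m)%N + mu / 2)); last lra.
    by apply: (le_trans step); rewrite ler_wpM2r//; lra.
  have : err (k0 + m)%N.+1 <= rho * err (k0 + m)%N.
    rewrite /rho mulrAC ler_pdivlMr// mulrC.
    have : 0 <= s - sigma (k0 + m)%N by lra.
    by move=> /ler_wpM2l/(_ _ _ dec); lra.
  rewrite addnS exprS -mulrA => /le_trans; apply.
  by rewrite ler_wpM2l.
rewrite -(cvg_shiftn k0); apply/cvgrPdist_le => e e0.
have : rho ^+ m * delta @[m --> \oo] --> (0 : R).
  rewrite -(mul0r delta); apply: cvgM; last exact: cvg_cst.
  by apply: cvg_expr; rewrite ger0_norm// ltr_pdivrMr//; lra.
move=> /cvgrPdist_le/(_ e e0); apply: filterS => m /=.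
rewrite sub0r normrN ger0_norm ?mulr_ge0 ?exprn_ge0// => rhom.
rewrite -normrN opprB (le_trans (mxnorm_le_enorm _))// addnC.
exact: le_trans (contr m) rhom.
Qed.

Hypothesis nu_range : 0 < nu <= 1.
Hypothesis Hf_ge0 : 0 <= Hf.
Hypothesis hessian_holder : forall x y,
     sublevel_nbhd f x0 (radius_d Ug UH) x ->
     sublevel_nbhd f x0 (radius_d Ug UH) y ->
     specnorm (hessian f y - hessian f x) <= Hf * enorm (y - x) `^ nu.

Lemma newton_residual_holder y : sublevel f x0 y -> enorm (y - xs) <= 1 ->
  enorm (hessian f y *m (y - xs) - gradient f y)
  <= Hf * enorm (y - xs) `^ (1 + nu).
Proof.
move=> yx0 y1; have /andP[nu0 _] := nu_range; have E0 := enorm_ge0 (y - xs).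
have -> : enorm (y - xs) `^ (1 + nu) = enorm (y - xs) `^ nu * enorm (y - xs).
  rewrite powRD ?powRr1 1?mulrC//; apply/implyP => /eqP; lra.
rewrite mulrA; apply: newton_residual_le => // t /andP[t0 t1].
have dist : enorm (y + t *: (xs - y) - y) <= enorm (y - xs).
  by rewrite addrC addKr enormZ ger0_norm// enormB ler_piMl// enorm_ge0.
have rd1 : 1 <= radius_d Ug UH by rewrite le_max; apply/orP; left; lra.
apply: le_trans (hessian_holder _ _) _.
- by exists y => //; rewrite subrr enorm0; lra.
- by exists y => //; apply: le_trans dist (le_trans y1 rd1).
apply: (ler_wpM2l Hf_ge0).
by apply: (ge0_ler_powR (ltW nu0) _ _ dist); exact: enorm_ge0.
Qed.

(** Each of the three terms bounding the new error is a power of the old error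
    E <= 1 with exponent at least min(1 + nu, 3/2): sigma E <= sqrt (gamma L)
    E^(3/2), the Newton residual is at most Hf E^(1 + nu), and the
    conjugate gradient residual is at most L sqrt(L) E^(3/2) / 6.  The
    constant depends on the sequence through the frozen value of gamma. *)
Lemma iterates_rate : exists C, forall k, (k0 <= k)%N -> gen k.+1 ->
  err k.+1 <= C * err k `^ Num.min (1 + nu) (3 / 2).
Proof.
set m := Num.min _ _.
exists (2 / mu * (2 * Num.sqrt (gam k0 * L) + Hf + L * Num.sqrt L / 6)).
move=> k kk genS; have genk := generatedW (leqnSn _) genS.
have [xb gamE _] := iterates_stay kk genk.
have [_ step] := iterate_step kk genS.
have mu0 := mu_gt0; have gam0 := gam_gt0 genk; rewrite gamE in gam0.
have gL := gradient_lipschitz gradient_diff xs_critical hessian_osc xb.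
rewrite -/L -/(err k) in gL.
have E1 : err k <= 1 by exact: le_trans xb delta_le1.
have Ek : 0 < err k.
  rewrite enorm_gt0 subr_eq0; apply/eqP => xk.
  by have [_ _ /(_ _ (leqnn _))[]] := genS; rewrite xk xs_critical eqxx.
have E32 : err k * Num.sqrt (err k) <= err k `^ m.
  rewrite -powR_three_halves ?(ltW Ek)// ger_powR ?Ek//.
  by rewrite /m ge_min lexx orbT.
have Enu : err k `^ (1 + nu) <= err k `^ m.
  by rewrite ger_powR ?Ek// /m ge_min lexx.
have fk : f (x k) <= f x0.
  have /andP[e0 _] := eta_range; have /andP[t0 _] := theta_range.
  by have [] := generated_monotone gamma0_ge1 (ltW e0) (ltW t0) genk.
have holder := newton_residual_holder fk E1; rewrite -/(err k) in holder.
set G := enorm (gradient f (x k)) in step gL *.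
have G0 : 0 <= G by exact: enorm_ge0.
have sq : sigma k <= Num.sqrt (gam k0 * L) * Num.sqrt (err k).
  rewrite -sqrtrM ?mulr_ge0 ?(ltW gam0)// ler_wsqrtr// -mulrA.
  by rewrite ler_wpM2l// ltW.
have t1 : sigma k * err k <= Num.sqrt (gam k0 * L) * err k `^ m.
  apply: (@le_trans _ _ (Num.sqrt (gam k0 * L) * (err k * Num.sqrt (err k)))).
    by rewrite [err k * _]mulrC mulrA ler_wpM2r// ltW.
  by rewrite ler_wpM2l ?sqrtr_ge0.
have t2 : Hf * err k `^ (1 + nu) <= Hf * err k `^ m by rewrite ler_wpM2l.
have t3 : G * Num.sqrt G <= L * Num.sqrt L * err k `^ m.
  apply: (@le_trans _ _ (L * err k * (Num.sqrt L * Num.sqrt (err k)))).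
    by rewrite ler_pM ?sqrtr_ge0// -sqrtrM// ler_wsqrtr.
  rewrite mulrACA ler_wpM2l// mulr_ge0// sqrtr_ge0.
have half : mu / 2 * err k.+1 <= (2 * sigma k + mu / 2) * err k.+1.
  rewrite ler_wpM2r ?enorm_ge0//; have : 0 <= sigma k by exact: sqrtr_ge0.
  lra.
rewrite -(@ler_pM2l _ (mu / 2)); last lra.
have -> u v : mu / 2 * (2 / mu * u * v) = u * v by field; lra.
apply: (le_trans half); apply: (le_trans step).
move: (enorm _) (_ `^ _) (_ `^ _) holder t1 t2 t3 => a b c; lra.
Qed.

End LocalConvergence.

Theorem theorem4 (R : realType) (n : nat) (f : 'cV[R]_n -> R)
  (x0 : 'cV[R]_n) (gamma0 eta theta : R) (Ug UH nu Hf : R)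
  (xs : 'cV[R]_n) (mu : R)
  (f_C2 : twice_continuously_differentiable f)
  (compact_sublevel : compact (sublevel f x0))
  (gamma0_ge1 : 1 <= gamma0)
  (eta_range : 0 < eta <= 1 / 2)
  (theta_range : 0 < theta < 1)
  (Ug_gt0 : 0 < Ug)
  (UH_gt0 : 0 < UH)
  (Ug_bound : forall x, sublevel f x0 x -> enorm (gradient f x) <= Ug)
  (UH_bound : forall x, sublevel f x0 x -> specnorm (hessian f x) <= UH)
  (nu_range : 0 < nu <= 1)
  (Hf_ge1 : 1 <= Hf)
  (hessian_holder : forall x y,
     sublevel_nbhd f x0 (radius_d Ug UH) x ->
     sublevel_nbhd f x0 (radius_d Ug UH) y ->
     specnorm (hessian f y - hessian f x) <= Hf * enorm (y - x) `^ nu)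
  (xs_min : nondegenerate_local_minimizer f xs)
  (mu_gt0 : 0 < mu)
  (xs_mu : loewner_ge (hessian f xs) mu%:M) :
  exists delta c : R, [/\ 0 < delta, 0 < c &
    let S := cball xs delta `&` [set x | f x <= f xs + c] in
    forall (x : nat -> 'cV[R]_n) (gam : nat -> R) (k0 : nat),
      generated f x0 gamma0 eta theta x gam k0 ->
      S (x k0) ->
      [/\ forall k : nat, (k0 <= k)%N ->
            generated f x0 gamma0 eta theta x gam k -> S (x k),
          (forall k : nat, generated f x0 gamma0 eta theta x gam k) ->
            x k @[k --> \oo] --> xs,
          forall k : nat, (k0 <= k)%N ->
            generated f x0 gamma0 eta theta x gam k ->
            gradient f (x k) = 0 -> x k = xs
        & exists C : R, forall k : nat, (k0 <= k)%N ->
            generated f x0 gamma0 eta theta x gam k.+1 ->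
            enorm (x k.+1 - xs)
              <= C * enorm (x k - xs) `^ Num.min (1 + nu) (3 / 2)]].
Proof.
have [f_diff gradient_diff hessian_cont] := f_C2; have [xs_loc _] := xs_min.
have xs_critical := gradient_local_minimizer f_diff xs_loc.
have mu8 : 0 < mu / 8 by rewrite divr_gt0.
have [r r_gt0 osc] := specnorm_continuous_osc xs hessian_cont mu8.
set L := specnorm (hessian f xs) + mu / 8.
have L_gt0 : 0 < L by rewrite ltr_wpDl ?specnorm_ge0.
(* With L delta <= rho^2, the residual condition L sqrt (L delta) <= (3/4) mu
   holds. *)
pose rho := 3 / 4 * mu / L.
have rho_gt0 : 0 < rho by rewrite divr_gt0//; lra.
pose delta := Num.min r (Num.min 1 (rho ^+ 2 / L)).
have delta_gt0 : 0 < delta by rewrite !lt_min r_gt0 ltr01 divr_gt0// exprn_gt0.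
have delta_le1 : delta <= 1 by rewrite !ge_min lexx orbT.
have hessian_osc x y : cball xs delta x -> cball xs delta y ->
    specnorm (hessian f y - hessian f x) <= mu / 8.
  by move=> xb yb; apply: osc; [apply: le_trans xb _|apply: le_trans yb _];
     rewrite ge_min lexx.
have delta_small : L * Num.sqrt (L * delta) <= 3 / 4 * mu.
  have -> : 3 / 4 * mu = L * rho by rewrite /rho [RHS]mulrC divfK// gt_eqF.
  rewrite ler_pM2l// -[leRHS]ger0_norm ?(ltW rho_gt0)// -sqrtr_sqr ler_wsqrtr//.
  by rewrite mulrC -ler_pdivlMr// !ge_min lexx !orbT.
exists delta, 1; split=> // S x gam k0 _ [xk0_ball fk0].
have stay := iterates_stay f_diff gradient_diff gamma0_ge1 eta_range theta_range
  mu_gt0 xs_critical xs_mu hessian_osc delta_small xk0_ball.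
split.
- move=> k kk genk; have [xb _ fk] := stay _ _ _ kk genk.
  by split=> //=; exact: le_trans fk fk0.
- exact: (iterates_cvg f_diff gradient_diff gamma0_ge1 eta_range theta_range
    mu_gt0 xs_critical xs_mu (ltW delta_gt0) hessian_osc delta_small xk0_ball).
- move=> k kk genk; have [xb _ _] := stay _ _ _ kk genk.
  exact: (critical_point_unique gradient_diff mu_gt0 xs_critical xs_mu
    hessian_osc xb).
- exact: (iterates_rate f_diff gradient_diff gamma0_ge1 eta_range theta_range
    mu_gt0 xs_critical xs_mu delta_le1 hessian_osc delta_small gam xk0_ball
    nu_range (le_trans ler01 Hf_ge1) hessian_holder).
Qed.
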